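(* There exists an absolute constant $c>0$ such that the following holds. Let $G$ be a digraph with maximum degree $\Delta\ge 2$ and let $\mathrm{w}\colon E(G)\to\mathbb{R}_{+}$ be a weight function on the edges such that $\mathrm{w}^+(v)\ge 1$ for every vertex $v\in V(G)$. Then there is a directed cycle $C\subseteq G$ such that \[\mathrm{w}(C)\ \ge\ c\,\frac{\log\log\Delta}{\log\Delta}.\]
   Context: Digraphs are finite, without loops and without parallel edges; each edge is an ordered pair $(u,v)$ of distinct vertices, and both $(u,v)$ and $(v,u)$ may be present. $\mathbb{R}_+$ is the set of non-negative reals. The maximum degree is $\Delta:=\max_{v\in V(G)}\{\mathrm{d}^-(v),\mathrm{d}^+(v)\}$, where $\mathrm{d}^-,\mathrm{d}^+$ are in- and out-degree. The out-weight of $v$ is $\mathrm{w}^+(v):=\sum_{(v,u)\in E(G)}\mathrm{w}(v,u)$. The weight of a subgraph $H$ is $\mathrm{w}(H):=\sum_{e\in E(H)}\mathrm{w}(e)$. Cycles are directed cycles without repeated vertices (length $2$ is allowed). $\log$ is the natural logarithm. *)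

(* Defs.v *)
From HB Require Import structures.
From mathcomp Require Import all_boot all_order all_algebra.
From mathcomp Require Import reals exp.

Set Implicit Arguments.
Unset Strict Implicit.
Unset Printing Implicit Defensive.

Import Order.TTheory GRing.Theory Num.Theory.
Local Open Scope ring_scope.

(* A digraph on the finite vertex type V is an irreflexive relation e : rel V,
   (u, v) being an edge iff e u v. *)

Definition outdeg (V : finType) (e : rel V) (v : V) : nat :=
  #|[set u | e v u]|.

Definition indeg (V : finType) (e : rel V) (v : V) : nat :=
  #|[set u | e u v]|.

Definition maxdeg (V : finType) (e : rel V) : nat :=
  \max_(v : V) maxn (indeg e v) (outdeg e v).

(* An edge weighting is a total function V -> V -> R; only its values on edges
   are ever used. *)

Definition out_weight (R : realType) (V : finType) (e : rel V)
    (w : V -> V -> R) (v : V) : R :=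
  \sum_(u | e v u) w v u.

Definition weight (R : realType) (V : finType) (w : V -> V -> R)
    (F : {set V * V}) : R :=
  \sum_(a in F) w a.1 a.2.

(* A directed cycle is given by the cyclic sequence of its vertices. As e is
   irreflexive, a one-vertex sequence is not a cycle, while two-vertex ones
   are allowed; the empty sequence has to be excluded. *)
Definition dicycle (V : finType) (e : rel V) (C : seq V) : Prop :=
  C <> [::] /\ ucycle e C.

Definition cycle_edges (V : finType) (C : seq V) : {set V * V} :=
  [set (v, next C v) | v in C].

(* Main.v *)
(* Scale the weights so that every out-weight is 1, suppose that all cycles
   weigh less than eps = exp(-2t), and grow a simple path v_0, ..., v_i forever.
   Every vertex x with an edge to some v_j carries the danger
     exp(loss * sum_(j <= k <= i) w(x, v_k) - gain * w(v_j ... v_i)).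
   If more than half of the out-weight of the end v_i went back to the path,
   then, with v_j the earliest out-neighbour of v_i on the path, the cycle
   v_j ... v_i v_j would be light, so this one danger would already be at least
   exp(loss / 2 - gain * eps) = exp(loss / 4). But the total danger can be kept
   below that value: extend the path either by a heavy edge or by a uniformly
   random unvisited out-neighbour u of v_i. On average w(x, u) is at most
   1 / #neighbours for every x, while the path gains at least half of that, and
   the exponents are chosen so that the gain wins. Thus at least half of the
   out-weight always leads to unvisited vertices, and the path never ends. *)

Require Import Defs.
From HB Require Import structures.
From mathcomp Require Import all_boot all_order all_algebra.
From mathcomp Require Import boolp reals sequences exp.
From mathcomp Require Import ring lra.

Set Implicit Arguments.
Unset Strict Implicit.
Unset Printing Implicit Defensive.

Import Order.TTheory GRing.Theory Num.Theory.
Local Open Scope ring_scope.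

(** * Exponential estimates for averaging *)

Lemma expR_sub1_le (R : realType) (a t : R) :
  0 <= a <= t -> expR a - 1 <= a * expR t.
Proof.
move=> /andP[a0 at_].
have h : 1 - a <= expR (- a) by apply: expR_ge1Dx.
have eat : expR a <= expR t by rewrite ler_expR.
have e1 : expR a * expR (- a) = 1 by exact: expRxMexpNx_1.
have := expR_gt0 a; nra.
Qed.

Lemma expRN_le (R : realType) (b t : R) :
  0 <= b <= t -> expR (- b) <= 1 - b / (1 + t).
Proof.
move=> /andP[b0 bt].
have t1 : 0 < 1 + t by lra.
have e1 : expR b * expR (- b) = 1 by exact: expRxMexpNx_1.
have h : 1 + b <= expR b by exact: expR_ge1Dx.
have p0 := expR_gt0 (- b).
have h2 : (1 + b) * expR (- b) <= 1 by rewrite -[leRHS]e1 ler_wpM2r // ltW.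
have -> : 1 - b / (1 + t) = (1 + t - b) / (1 + t) by field; rewrite gt_eqF.
by rewrite ler_pdivlMr //; nra.
Qed.

Lemma expR_ge_lin (R : realType) (t : R) : 100 <= t -> 24 * t + 1 <= expR t.
Proof.
move=> t100; have h : 1 + t / 2 <= expR (t / 2) by exact: expR_ge1Dx.
have -> : expR t = expR (t / 2) * expR (t / 2) by rewrite -expRD -splitr.
have : (1 + t / 2) * (1 + t / 2) <= expR (t / 2) * expR (t / 2).
  by rewrite ler_pM //; lra.
nra.
Qed.

(** Here [a] stands for loss exponents and [b] for gain exponents of the candidates [u]. Losses add
    at most [t * expR t ^+ 3] and gains remove at least [expR t ^+ 4 / 24], which is larger by at
    least 1. *)
Lemma sum_expR_sub_le (R : realType) (V : finType) (N : {set V}) (t : R)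
    (a b : V -> R) :
  100 <= t ->
  (forall u, u \in N -> 0 <= a u <= t) ->
  (forall u, u \in N -> 0 <= b u <= 2 * t) ->
  \sum_(u in N) a u <= t * expR t ^+ 2 ->
  t * expR t ^+ 4 / 8 <= \sum_(u in N) b u ->
  \sum_(u in N) expR (a u - b u) <= #|N|%:R - 1.
Proof.
move=> t100 Ha Hb sa sb.
have step : \sum_(u in N) expR (a u - b u) <=
    \sum_(u in N) (a u * expR t + (1 - b u / (1 + 2 * t))).
  apply: ler_sum => u uN.
  have h1 := expR_sub1_le (Ha u uN); have h2 := expRN_le (Hb u uN).
  have /andP[b0 _] := Hb u uN.
  (* As [(expR a - 1) * (1 - expR (- b)) >= 0], [expR (a - b)] is at most
     [expR a + expR (- b) - 1]. *)
  have a1 : 1 <= expR (a u) by have := expR_ge1Dx (a u); have /andP[] := Ha u uN; lra.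
  have b1 : expR (- b u) <= 1 by rewrite expR_le1 oppr_le0.
  have := expR_gt0 (- b u).
  by rewrite expRD; nra.
apply: le_trans step _.
rewrite big_split /= sumrB -mulr_suml -mulr_suml sumr_const.
have hE := expR_ge_lin t100; set E := expR t in sa sb hE *.
set A := \sum_(u in N) a u in sa *; set B := \sum_(u in N) b u in sb *.
have t1 : 0 < 1 + 2 * t by lra.
have E0 : 0 < E by lra.
have hA : A * E <= t * E ^+ 3.
  by rewrite [E ^+ 3]exprSr mulrA ler_pM2r.
have hB : E ^+ 4 / 24 <= B / (1 + 2 * t).
  rewrite ler_pdivlMr //; apply: le_trans sb.
  have : 0 < E ^+ 4 by apply: exprn_gt0.
  nra.
have h4 : t * E ^+ 3 + 1 <= E ^+ 4 / 24.
  have h3 : 1 <= E ^+ 3 by apply: exprn_ege1; lra.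
  rewrite [E ^+ 4]exprS; nra.
lra.
Qed.

(** * The danger potential and one extension step *)

(* An edge of weight above eps = expR t ^- 2 lies on no light cycle, so cutting
   it off at eps loses nothing and makes [lossrate t * trunc_weight p t x u]
   at most t. *)
Definition trunc_weight (R : realType) (V : finType) (p : V -> V -> R) (t : R)
    (x u : V) : R :=
  Num.min (p x u) (expR t ^- 2).

Definition lossrate (R : realType) (t : R) : R := t * expR t ^+ 2.
(** With [eps = expR t ^- 2], this is [lossrate t / (4 * eps)], so a path lighter than [eps] gains
    at most [lossrate t / 4]. *)
Definition gainrate (R : realType) (t : R) : R := t * expR t ^+ 4 / 4.

(* The total danger at x after the path with end v and total dangers g has been
   extended by u; the last summand is the danger starting at v_j = u. *)
Definition step_pot (R : realType) (V : finType) (e : rel V) (p : V -> V -> R)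
    (t : R) (g : V -> R) (v u x : V) : R :=
  expR (lossrate t * trunc_weight p t x u)
    * (expR (- (gainrate t * p v u)) * g x + (e x u)%:R).

(** A level that a step can preserve: new dangers add at most [maxdeg e * expR t], and averaging
    over a candidate set [N] removes at least a fraction [1 / #|N| >= 1 / maxdeg e] of the old
    ones. *)
Definition pot_bound (R : realType) (V : finType) (e : rel V) (t : R) : R :=
  (maxdeg e)%:R ^+ 2 * expR t.

Lemma indeg_le_maxdeg (V : finType) (e : rel V) (v : V) :
  (indeg e v <= maxdeg e)%N.
Proof.
apply: (leq_trans (leq_maxl (indeg e v) (outdeg e v))).
exact: (leq_bigmax v).
Qed.

Lemma outdeg_le_maxdeg (V : finType) (e : rel V) (v : V) :
  (outdeg e v <= maxdeg e)%N.
Proof.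
apply: (leq_trans (leq_maxr (indeg e v) (outdeg e v))).
exact: (leq_bigmax v).
Qed.

Lemma trunc_exponent (R : realType) (V : finType) (p : V -> V -> R) (t : R)
    (x u : V) :
  0 <= t -> 0 <= p x u -> 0 <= lossrate t * trunc_weight p t x u <= t.
Proof.
move=> t0 p0; have E0 := expR_gt0 t.
have E2 : 0 < expR t ^+ 2 by apply: exprn_gt0.
apply/andP; split.
  apply: mulr_ge0; first by apply: mulr_ge0 => //; exact: ltW.
  by rewrite le_min p0 invr_ge0 ltW.
rewrite /lossrate -mulrA ler_piMr // mulrC -ler_pdivlMr // mul1r.
by rewrite ge_min lexx orbT.
Qed.

Lemma sum_inedges_le (R : realType) (V : finType) (e : rel V)
    (p : V -> V -> R) (t : R) (u : V) :
  0 <= t -> (forall x y, 0 <= p x y) ->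
  \sum_x expR (lossrate t * trunc_weight p t x u) * (e x u)%:R
    <= (maxdeg e)%:R * expR t.
Proof.
move=> t0 p0.
apply: (@le_trans _ _ (\sum_x expR t * (e x u)%:R)).
  apply: ler_sum => x _; apply: ler_wpM2r => //.
  by rewrite ler_expR; have /andP[] := trunc_exponent t0 (p0 x u).
rewrite -mulr_sumr mulrC ler_wpM2r ?expR_ge0 // -natr_sum ler_nat.
apply: leq_trans (indeg_le_maxdeg e u).
by rewrite -big_mkcond sum1_card /indeg cardsE.
Qed.

Lemma exists_good_step (R : realType) (V : finType) (e : rel V)
    (p : V -> V -> R) (t : R) (g : V -> R) (v : V) (N : {set V}) :
  100 <= t -> (2 <= maxdeg e)%N ->
  (forall x y, 0 <= p x y) -> (forall x, \sum_y p x y = 1) ->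
  (forall x, 0 <= g x) -> \sum_x g x <= pot_bound e t ->
  (forall u, u \in N -> e v u) -> 1 / 2 <= \sum_(u in N) p v u ->
  exists2 u, u \in N & \sum_x step_pot e p t g v u x <= pot_bound e t.
Proof.
move=> t100 D2 p0 p1 g0 gB Nv sN.
have t0 : 0 <= t by lra.
have hE := expR_ge_lin t100.
have E0 := expR_gt0 t.
have D2' : 2 <= (maxdeg e)%:R :> R by rewrite ler_nat.
have split_step u : \sum_x step_pot e p t g v u x <=
    \sum_x expR (lossrate t * trunc_weight p t x u - gainrate t * p v u) * g x
    + (maxdeg e)%:R * expR t.
  apply: (le_trans _ (lerD (lexx _) (sum_inedges_le e u t0 p0))).
  rewrite -big_split /= ler_sum // => x _.
  by rewrite /step_pot mulrDr mulrA -expRD.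
(* A gain exponent of [2 * t] beats every loss exponent, as these are at most [t]. *)
have [/existsP[u /andP[uN big]]|] :=
    boolP [exists u, (u \in N) && (2 * t <= gainrate t * p v u)].
  exists u => //; apply: le_trans (split_step u) _.
  have h : \sum_x expR (lossrate t * trunc_weight p t x u - gainrate t * p v u)
      * g x <= expR (- t) * pot_bound e t.
    apply: (@le_trans _ _ (\sum_x expR (- t) * g x)); last first.
      by rewrite -mulr_sumr ler_wpM2l ?expR_ge0.
    apply: ler_sum => x _; apply: ler_wpM2r => //; rewrite ler_expR.
    have /andP[_] := trunc_exponent t0 (p0 x u); lra.
  apply: le_trans (lerD h (lexx _)) _.
  rewrite /pot_bound mulrCA (mulrC (expR (- t))) expRxMexpNx_1 mulr1.
  move: hE E0; set E := expR t; set D := (maxdeg e)%:R => hE E0.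
  have : D * 2 <= D ^+ 2 by rewrite expr2; nra.
  have : 2 <= E by lra.
  have : 0 <= D by lra.
  nra.
rewrite negb_exists => /forallP small.
have small' u : u \in N -> gainrate t * p v u <= 2 * t.
  by move=> uN; have := small u; rewrite uN /= -ltNge => /ltW.
have gain0 : 0 <= gainrate t.
  by rewrite /gainrate !mulr_ge0 ?exprn_ge0 ?expR_ge0 ?invr_ge0.
have loss0 : 0 <= lossrate t by rewrite /lossrate mulr_ge0 ?exprn_ge0 ?expR_ge0.
(* Out-weight 1 bounds the total loss exponent by [lossrate t]; weight 1/2 in [N] makes the total
   gain exponent at least [gainrate t / 2]. *)
have avg x : \sum_(u in N)
    expR (lossrate t * trunc_weight p t x u - gainrate t * p v u) <= #|N|%:R - 1.
  apply: (sum_expR_sub_le t100) => [u uN|u uN||].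
  - exact: trunc_exponent.
  - by rewrite small' // mulr_ge0.
  - rewrite -mulr_sumr -[leRHS]mulr1 ler_wpM2l // -(p1 x).
    rewrite [leRHS](bigID (mem N)) /= -[leLHS]addr0 lerD ?sumr_ge0 //.
    by apply: ler_sum => u _; rewrite ge_min lexx.
  - rewrite -mulr_sumr /gainrate.
    have : 0 <= t * expR t ^+ 4 by rewrite mulr_ge0 // exprn_ge0 // ltW.
    nra.
have cardN : (#|N| <= maxdeg e)%N.
  apply: leq_trans (outdeg_le_maxdeg e v); apply: subset_leq_card.
  by apply/subsetP => u /Nv; rewrite inE.
have total : \sum_(u in N) \sum_x step_pot e p t g v u x <=
    \sum_(u in N) pot_bound e t.
  apply: (le_trans (ler_sum _ (fun u _ => split_step u))).
  rewrite big_split /= !sumr_const exchange_big /=.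
  have h : \sum_x \sum_(u in N)
      expR (lossrate t * trunc_weight p t x u - gainrate t * p v u) * g x
      <= (#|N|%:R - 1) * pot_bound e t.
    have N1 : 1 <= #|N|%:R :> R.
      rewrite ler1n card_gt0; apply/eqP => N0; move: sN.
      by rewrite N0 big_set0; lra.
    apply: (@le_trans _ _ (\sum_x (#|N|%:R - 1) * g x)); last first.
      by rewrite -mulr_sumr ler_wpM2l // subr_ge0.
    apply: ler_sum => x _; rewrite -mulr_suml; exact: ler_wpM2r.
  apply: (le_trans (lerD h (lexx _))).
  rewrite -[X in _ + X]mulr_natl -[leRHS]mulr_natl mulrBl mul1r -lerBrDl.
  rewrite opprB addrA [X in X - _]addrC addrK /pot_bound expr2 -!mulrA.
  by rewrite ler_wpM2r ?mulr_ge0 ?ler_nat // ltW.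
apply/exists_inP; rewrite -[X in is_true X]negbK negb_exists_in.
apply/negP => /forall_inP bad.
have [u uN] : exists u, u \in N.
  apply/set0Pn/eqP => N0; move: sN.
  by rewrite N0 big_set0; lra.
have : \sum_(u in N) pot_bound e t < \sum_(u in N) \sum_x step_pot e p t g v u x.
  rewrite (bigD1 u) //= [ltRHS](bigD1 u) //= ltr_leD //.
    by rewrite ltNge bad.
  by apply: ler_sum => z /andP[zN _]; apply: ltW; rewrite ltNge bad.
by rewrite ltNge total.
Qed.

(** * Dangers along a path and the cycles closing it *)

(* Paths are stored with their end first: v :: q stands for the path
   last v q -> ... -> v of the digraph. *)
Fixpoint rpath_weight (R : realType) (V : finType) (p : V -> V -> R)
    (v : V) (q : seq V) : R :=
  if q is u :: q' then p u v + rpath_weight p u q' else 0.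

(** For a one-vertex path, the default [u] of [head] only enters a factor of the zero potential. *)
Fixpoint path_pot (R : realType) (V : finType) (e : rel V) (p : V -> V -> R)
    (t : R) (s : seq V) : V -> R :=
  if s is u :: s' then step_pot e p t (path_pot e p t s') (head u s') u
  else fun=> 0.

Lemma step_pot_ge0 (R : realType) (V : finType) (e : rel V)
    (p : V -> V -> R) (t : R) (g : V -> R) (v u x : V) :
  0 <= g x -> 0 <= step_pot e p t g v u x.
Proof.
by move=> g0; rewrite /step_pot mulr_ge0 ?addr_ge0 ?mulr_ge0 ?expR_ge0.
Qed.

Lemma path_pot_ge0 (R : realType) (V : finType) (e : rel V)
    (p : V -> V -> R) (t : R) (s : seq V) (x : V) :
  0 <= path_pot e p t s x.
Proof. by elim: s => //= u s IH; exact: step_pot_ge0. Qed.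

Lemma rpath_weight_ge0 (R : realType) (V : finType) (p : V -> V -> R)
    (v : V) (q : seq V) :
  (forall x y, 0 <= p x y) -> 0 <= rpath_weight p v q.
Proof. by move=> p0; elim: q v => //= u q IH v; rewrite addr_ge0. Qed.

(** Unrolled, the potential has one exponential for each out-neighbour of [x] on the path. Only that
    of [last v q] is kept; [q'] is the part of the path before it. *)
Lemma path_pot_ge (R : realType) (V : finType) (e : rel V)
    (p : V -> V -> R) (t : R) (x v : V) (q q' : seq V) :
  e x (last v q) ->
  expR (lossrate t * \sum_(k <- v :: q) trunc_weight p t x k
        - gainrate t * rpath_weight p v q)
    <= path_pot e p t (v :: q ++ q') x.
Proof.
elim: q v => [|u q IH] v /= exl.
  rewrite big_seq1 mulr0 subr0 /step_pot exl -[leLHS]mulr1.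
  by rewrite ler_wpM2l ?expR_ge0 // lerDr mulr_ge0 ?expR_ge0 ?path_pot_ge0.
rewrite big_cons /step_pot mulrDr -addrA expRD ler_wpM2l ?expR_ge0 //.
apply: (@le_trans _ _
    (expR (- (gainrate t * p u v)) * path_pot e p t (u :: q ++ q') x)).
  rewrite mulrDr opprD addrCA expRD ler_wpM2l ?expR_ge0 //.
  exact: IH.
by rewrite lerDl.
Qed.

(** Keeping the start [y0] of the cycle apart from the moving vertex [y] lets the induction run; the
    use is with [y0 = y]. *)
Lemma sum_prev_at (R : realType) (V : finType) (p : V -> V -> R)
    (y0 y : V) (q : seq V) :
  uniq (y :: q) -> y0 \notin q ->
  \sum_(k <- q) p k (prev_at k y0 y q) + p y0 (prev_at y0 y0 y q) =
  rpath_weight p y q + p y0 (last y q).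
Proof.
elim: q y => [|z q IH] y /=.
  by rewrite big_nil eqxx.
move=> /andP[yq /andP[zq uq]]; rewrite inE negb_or => /andP[y0z y0q].
rewrite big_cons eqxx (negbTE y0z) -!addrA -IH /= ?zq //.
congr (_ + (_ + _)).
apply: eq_big_seq => k kq; case: eqVneq => // kz.
by rewrite -kz kq in zq.
Qed.

Lemma weight_rev_cycle (R : realType) (V : finType) (p : V -> V -> R)
    (v : V) (q : seq V) :
  uniq (v :: q) ->
  weight p (cycle_edges (rev (v :: q))) =
  rpath_weight p v q + p v (last v q).
Proof.
move=> uq; rewrite /weight /cycle_edges big_imset /=; last first.
  by move=> x y _ _ [].
rewrite -big_uniq ?rev_uniq //= (perm_big (v :: q)) /=; last by rewrite perm_rev.
rewrite -sum_prev_at //; last by case/andP: uq.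
rewrite big_cons addrC next_rev //=; congr (_ + _).
by apply: eq_bigr => k _; rewrite next_rev.
Qed.

Lemma dicycle_rev (V : finType) (e : rel V) (v : V) (q : seq V) :
  uniq (v :: q) -> path (fun x y => e y x) v q -> e v (last v q) ->
  dicycle e (rev (v :: q)).
Proof.
move=> uq pq evl; split; first by move/(congr1 size); rewrite size_rev.
by rewrite /ucycle rev_uniq uq rev_cycle /= rcons_path pq /= evl.
Qed.

Lemma weight_to_path_le (R : realType) (V : finType) (e : rel V)
    (p : V -> V -> R) (t : R) (v : V) (s : seq V) :
  0 <= t -> irreflexive e ->
  (forall x y, 0 <= p x y) -> (forall x y, ~~ e x y -> p x y = 0) ->
  (forall C, dicycle e C -> weight p (cycle_edges C) < expR t ^- 2) ->
  uniq (v :: s) -> path (fun x y => e y x) v s ->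
  path_pot e p t (v :: s) v < expR (lossrate t / 4) ->
  \sum_(k <- v :: s) p v k <= 1 / 2.
Proof.
move=> t0 irr p0 pN light us ps potlt; rewrite leNgt; apply/negP => heavy.
have close q q' : s = q ++ q' -> e v (last v q) ->
    rpath_weight p v q + p v (last v q) < expR t ^- 2.
  move=> sE evl; move: us ps; rewrite sE -cat_cons cat_uniq cat_path.
  move=> /andP[uq _] /andP[pq _].
  by rewrite -weight_rev_cycle //; apply: light; exact: dicycle_rev.
(* An edge from [v] back to the path closes a light cycle, so it weighs less than the truncation
   level. *)
have truncE k : k \in s -> trunc_weight p t v k = p v k.
  move=> ks; rewrite /trunc_weight; apply/min_idPl.
  have [evk|/pN ->] := boolP (e v k); last by rewrite invr_ge0 exprn_ge0 ?expR_ge0.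
  have [q [q' sE]] : exists q q', s = rcons q k ++ q'.
    by case/splitPr: ks => q q'; exists q, q'; rewrite cat_rcons.
  have := close (rcons q k) q' sE; rewrite last_rcons => /(_ evk) /ltW.
  by apply: le_trans; rewrite lerDr rpath_weight_ge0.
have [|hasN] := boolP (has (e v) (rev s)); last first.
  move: heavy; rewrite big_cons pN ?irr // add0r big1_seq; first by lra.
  move=> k /= ks; apply: pN; move/hasPn: hasN; apply.
  by rewrite mem_rev.
move=> has_s.
(* Paths are stored backwards, so the first hit in [rev s] is the earliest out-neighbour [z]; all
   weight back to the path lands on the part from [z] on. *)
have [z [q1 [q2 [rE evz q1N]]]] : exists z q1 q2,
    [/\ rev s = rcons q1 z ++ q2, e v z & ~~ has (e v) q1].
  by case/split_find: has_s => z q1 q2; exists z, q1, q2.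
have sE : s = rcons (rev q2) z ++ rev q1.
  by rewrite -[s]revK rE rev_cat rev_rcons -cats1 -catA.
have evl : e v (last v (rcons (rev q2) z)) by rewrite last_rcons.
have W := close _ _ sE evl.
have := @path_pot_ge _ _ e p t v v _ (rev q1) evl.
rewrite -sE => /le_lt_trans /(_ potlt); rewrite ltr_expR.
have -> : \sum_(k <- v :: rcons (rev q2) z) trunc_weight p t v k =
    \sum_(k <- v :: s) p v k.
  rewrite !big_cons; congr (_ + _).
    rewrite pN ?irr // /trunc_weight pN ?irr //.
    by apply/min_idPl; rewrite invr_ge0 exprn_ge0 ?expR_ge0.
  rewrite sE big_cat /= [X in _ = _ + X]big1_seq; last first.
    move=> k /=; rewrite mem_rev => kq; apply: pN.
    by move/hasPn: q1N; apply.
  rewrite addr0; apply: eq_big_seq => k kq; apply: truncE.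
  by rewrite sE mem_cat kq.
have W' : rpath_weight p v (rcons (rev q2) z) <= expR t ^- 2.
  by apply: le_trans (ltW W); rewrite lerDl.
have E2 : 0 < expR t ^+ 2 by rewrite exprn_gt0 ?expR_gt0.
have l0 : 0 <= lossrate t by rewrite /lossrate mulr_ge0 // ltW.
have g0 : 0 <= gainrate t.
  by rewrite /gainrate !mulr_ge0 ?exprn_ge0 ?expR_ge0 ?invr_ge0.
have gW : gainrate t * rpath_weight p v (rcons (rev q2) z) <= lossrate t / 4.
  apply: le_trans (ler_wpM2l g0 W') _.
  rewrite /gainrate /lossrate (_ : 4 = 2 + 2)%N // exprD.
  by rewrite le_eqVlt; apply/orP; left; apply/eqP; field; rewrite gt_eqF // expR_gt0.
have := ler_wpM2l l0 (ltW heavy); lra.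
Qed.

(** * Growing the path forever *)

Lemma extend_path (R : realType) (V : finType) (e : rel V)
    (p : V -> V -> R) (t : R) (v : V) (s : seq V) :
  100 <= t -> (2 <= maxdeg e)%N -> irreflexive e ->
  (forall x y, 0 <= p x y) -> (forall x y, ~~ e x y -> p x y = 0) ->
  (forall x, \sum_y p x y = 1) ->
  (forall C, dicycle e C -> weight p (cycle_edges C) < expR t ^- 2) ->
  pot_bound e t < expR (lossrate t / 4) ->
  uniq (v :: s) -> path (fun x y => e y x) v s ->
  \sum_x path_pot e p t (v :: s) x <= pot_bound e t ->
  exists u, [/\ uniq (u :: v :: s), e v u &
    \sum_x path_pot e p t (u :: v :: s) x <= pot_bound e t].
Proof.
move=> t100 D2 irr p0 pN p1 light Bsmall us ps potB.
have t0 : 0 <= t by lra.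
have potv : path_pot e p t (v :: s) v < expR (lossrate t / 4).
  apply: le_lt_trans Bsmall; apply: le_trans potB.
  by rewrite (bigD1 v) //= lerDl sumr_ge0 // => x _; exact: path_pot_ge0 (v :: s) x.
have half := weight_to_path_le t0 irr p0 pN light us ps potv.
pose N := [set u | e v u & u \notin v :: s].
have Nhalf : 1 / 2 <= \sum_(u in N) p v u.
  have : \sum_y p v y = \sum_(k <- v :: s) p v k + \sum_(u in N) p v u.
    rewrite [X in _ = X + _]big_uniq // (bigID (mem (v :: s))) /=; congr (_ + _).
    rewrite (bigID (e v)) /= [X in _ + X]big1 ?addr0.
      by apply: eq_bigl => u; rewrite !inE andbC.
    by move=> u /andP[_ /pN].
  rewrite p1; lra.
have [|u] := exists_good_step (v := v) t100 D2 p0 p1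
    (path_pot_ge0 e p t (v :: s)) potB _ Nhalf.
  by move=> u; rewrite inE => /andP[].
by rewrite inE => /andP[evu unew] uB; exists u; split; rewrite // cons_uniq unew.
Qed.

Lemma heavy_cycle_normalized (R : realType) (V : finType) (e : rel V)
    (p : V -> V -> R) (t : R) :
  100 <= t -> (2 <= maxdeg e)%N -> irreflexive e ->
  (forall x y, 0 <= p x y) -> (forall x y, ~~ e x y -> p x y = 0) ->
  (forall x, \sum_y p x y = 1) ->
  pot_bound e t < expR (lossrate t / 4) ->
  exists C, dicycle e C /\ expR t ^- 2 <= weight p (cycle_edges C).
Proof.
move=> t100 D2 irr p0 pN p1 Bsmall.
apply: contrapT => noC.
have light C : dicycle e C -> weight p (cycle_edges C) < expR t ^- 2.
  by move=> cC; rewrite ltNge; apply/negP => le; apply: noC; exists C.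
have long n : exists v s, [/\ size s = n, uniq (v :: s),
    path (fun x y => e y x) v s &
    \sum_x path_pot e p t (v :: s) x <= pot_bound e t].
  elim: n => [|n [v [s [sn us ps sB]]]].
    have [v _] : exists v : V, v \in V.
      apply/existsP; apply: contraLR D2; rewrite negb_exists => /forallP V0.
      by rewrite /maxdeg big1 // => v; have := V0 v.
    exists v, [::]; split=> //=.
    apply: le_trans (_ : (maxdeg e)%:R * expR t <= _).
      apply: le_trans (sum_inedges_le e v _ p0); last by lra.
      by apply: ler_sum => x _; rewrite /step_pot mulr0 add0r.
    rewrite /pot_bound ler_wpM2r ?expR_ge0 // expr2 ler_peMl // ler1n.
    exact: ltnW.
  have [u [us' evu uB]] := extend_path t100 D2 irr p0 pN p1 light Bsmall us ps sB.
  by exists u, (v :: s); split; rewrite //= ?sn // evu.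
(* This path would have [#|V| + 1] distinct vertices. *)
have [v [s [sn us _ _]]] := long #|V|.
by have := max_card (mem (v :: s)); rewrite (card_uniqP us) /= sn ltnn.
Qed.

(** * Normalization and the choice of [t] *)

(** Out-weights are at least 1, so dividing by them only lowers weights, and a heavy cycle stays
    heavy for [w]. *)
Lemma heavy_cycle (R : realType) (V : finType) (e : rel V) (w : V -> V -> R)
    (t : R) :
  100 <= t -> (2 <= maxdeg e)%N -> irreflexive e ->
  (forall u v, e u v -> 0 <= w u v) -> (forall v, 1 <= out_weight e w v) ->
  ln (maxdeg e)%:R <= lossrate t / 16 ->
  exists C, dicycle e C /\ expR t ^- 2 <= weight w (cycle_edges C).
Proof.
move=> t100 D2 irr w0 w1 lnD.
pose p x y := if e x y then w x y / out_weight e w x else 0.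
have out0 x : 0 < out_weight e w x by apply: lt_le_trans (w1 x).
have [||||C [cC wC]] := @heavy_cycle_normalized R V e p t t100 D2 irr.
- move=> x y; rewrite /p; case: ifP => // /w0 wxy.
  by rewrite divr_ge0 // ltW.
- by move=> x y; rewrite /p => /negbTE ->.
- move=> x; rewrite /p -big_mkcond /= -mulr_suml mulfV // gt_eqF //.
  exact: out0.
- have D0 : (maxdeg e)%:R \is @Num.pos R by rewrite posrE ltr0n (leq_trans _ D2).
  (* In logarithms the goal is [2 * ln (maxdeg e) + t < lossrate t / 4]; each summand takes at most
     half of the room. *)
  rewrite /pot_bound -{1}(lnK D0) -expRM_natl -expRD ltr_expR.
  have hE := expR_ge_lin t100.
  have : 16 <= expR t ^+ 2 by rewrite expr2; nra.
  move: lnD; rewrite /lossrate; nra.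
exists C; split=> //; apply: le_trans wC _.
rewrite /weight; apply: ler_sum => a.
case/imsetP => x xC -> /=.
case: cC => _ /andP[/next_cycle /(_ xC) exn _].
by rewrite /p exn ler_pdivrMr // ler_peMr // w0.
Qed.

Theorem theorem1p10 (R : realType) :
  exists c : R, 0 < c /\
    forall (V : finType) (e : rel V) (w : V -> V -> R),
      irreflexive e ->
      (2 <= maxdeg e)%N ->
      (forall u v : V, e u v -> 0 <= w u v) ->
      (forall v : V, 1 <= out_weight e w v) ->
      exists C : seq V,
        dicycle e C /\
        c * (ln (ln (maxdeg e)%:R) / ln (maxdeg e)%:R)
          <= weight w (cycle_edges C).
Proof.
exists (expR (- 400)); split; first exact: expR_gt0.
move=> V e w irr D2 w0 w1.
set L := ln (maxdeg e)%:R.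
have L0 : 0 < L by rewrite ln_gt0 // ltr1n.
(* For bounded degree a fixed [t = 200] works, as [L <= expR 400] and [ln L / L <= 1]. *)
have [y400|y400] := leP (ln L) 400.
  have [||C [cC wC]] := @heavy_cycle R V e w 200 _ D2 irr w0 w1.
  - by lra.
  - rewrite /lossrate -expRM_natl (_ : 2%:R * 200 = 400); last by ring.
    have : L <= expR 400 by rewrite -[L]lnK ?posrE // ler_expR.
    have := expR_gt0 (400 : R); rewrite -/L; lra.
  exists C; split=> //; apply: le_trans wC.
  rewrite -expRM_natl -expRN (_ : - (2%:R * 200) = - 400); last by ring.
  rewrite ler_piMr ?expR_ge0 // ler_pdivrMr // mul1r.
  exact/ltW/ln_sublinear.
set y := ln L in y400 *.
have y0 : 0 < y by lra.
have LE : L = expR y by rewrite lnK.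
have z0 : 0 < 64 * L / y by rewrite divr_gt0 // mulr_gt0.
(* Chosen so that [expR t ^- 2] is [y / L] up to the factor 64; [t >= y / 4] then gives
   [lossrate t >= 16 * L]. *)
pose t := ln (64 * L / y) / 2.
have E2 : expR t ^+ 2 = 64 * L / y.
  by rewrite -expRM_natl mulrC divfK ?pnatr_eq0 // lnK.
have ty : y / 4 <= t.
  suff : y / 2 <= ln (64 * L / y) by rewrite /t; lra.
  rewrite -ler_expR lnK // ler_pdivlMr // LE.
  have -> : expR y = expR (y / 2) * expR (y / 2) by rewrite -expRD -splitr.
  have : 1 + y / 2 <= expR (y / 2) by exact: expR_ge1Dx.
  nra.
have [||C [cC wC]] := @heavy_cycle R V e w t _ D2 irr w0 w1.
- by lra.
- have -> : lossrate t = 64 * (t / y) * L.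
    by rewrite /lossrate E2; field; rewrite gt_eqF.
  have : 1 / 4 <= t / y by rewrite ler_pdivlMr //; lra.
  rewrite -/L; nra.
exists C; split=> //; apply: le_trans wC.
have -> : expR t ^- 2 = 64^-1 * (y / L).
  by rewrite E2; field; rewrite !gt_eqF.
apply: ler_wpM2r; first by apply: divr_ge0; exact: ltW.
rewrite expRN lef_pV2 ?posrE ?expR_gt0 //.
have := @expR_ge1Dx R 400; lra.
Qed.
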